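(* Let $n\ge 1$ and let $S=(s_{i,j})_{i,j=1}^n$ be a real symmetric matrix with non-negative entries such that for all $i,j\in\{1,\ldots,n\}$: $s_{i,j}>0$ if $i+j=n$; $s_{i,j}>0$ if $i+j=n+1$; and $s_{i,j}=0$ if $i+j\ge n+2$. Let $m=(m_1,\ldots,m_n):\mathbb{H}\to\mathbb{H}^n$ be the solution of the vector Dyson equation $-\frac{1}{m(z)}=z+Sm(z)$, and let $\rho$ be its self-consistent density of states. Then the limit $$\lim_{E\to 0}\rho(E)\,|E|^{\frac{n-1}{n+1}}$$ (over real $E\neq 0$) exists and is positive.
   Context: $\mathbb{H}$ is the open complex upper half-plane. The vector Dyson equation is understood entrywise: $-1/m_k(z)=z+\sum_{j=1}^n s_{k,j}m_j(z)$ for all $k$ and all $z\in\mathbb{H}$. It is known that for every $z\in\mathbb{H}$ it has a unique solution $m(z)\in\mathbb{H}^n$. The self-consistent density of states is $\rho(E)=\lim_{\eta\searrow 0}\frac{1}{\pi n}\sum_{k=1}^n\operatorname{Im} m_k(E+i\eta)$ for real $E$. *)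

(* Defs.v *)
From HB Require Import structures.
From mathcomp Require Import all_boot all_order all_algebra.
From mathcomp Require Import all_classical all_reals all_analysis.
From mathcomp Require Import complex.
Set Implicit Arguments.
Unset Strict Implicit.
Unset Printing Implicit Defensive.

Import Order.TTheory GRing.Theory Num.Theory.
Import numFieldNormedType.Exports.

Local Open Scope classical_set_scope.
Local Open Scope ring_scope.
Local Open Scope complex_scope.

Definition upper_half_plane (R : realType) : set R[i] := [set z | 0 < complex.Im z].

(* A solution is a function on all of [R[i]], constrained only on the open upper
   half-plane; its values elsewhere are irrelevant. *)
Definition solves_vector_dyson (R : realType) (n : nat) (S : 'M[R]_n)
    (m : R[i] -> 'I_n -> R[i]) : Prop :=
  forall z : R[i], upper_half_plane z -> forall k : 'I_n,
    upper_half_plane (m z k) /\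
    - (m z k)^-1 = z + \sum_(j < n) (S k j)%:C * m z j.

Definition self_consistent_dos (R : realType) (n : nat)
    (m : R[i] -> 'I_n -> R[i]) (E : R) : R :=
  lim ((pi * n%:R)^-1 * \sum_(k < n) complex.Im (m (E +i* eta) k) @[eta --> 0^'+]).

(* [lim] takes the default value 0 on divergent families, so wherever the
   density is nonzero the defining limit does exist. *)
Lemma self_consistent_dos_cvg (R : realType) (n : nat)
    (m : R[i] -> 'I_n -> R[i]) (E : R) :
  self_consistent_dos m E != 0 ->
  cvg ((pi * n%:R)^-1 * \sum_(k < n) complex.Im (m (E +i* eta) k) @[eta --> 0^'+]).
Proof.
by move=> h; apply: contrapT => /dvgP dv; move: h; rewrite /self_consistent_dos dv eqxx.
Qed.

(* Main.v *)
Require Import Defs.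
From HB Require Import structures.
From mathcomp Require Import all_boot all_order all_algebra.
From mathcomp Require Import all_classical all_reals all_analysis.
From mathcomp Require Import complex.
From mathcomp Require Import ring lra zify.
Set Implicit Arguments.
Unset Strict Implicit.
Unset Printing Implicit Defensive.

Import Order.TTheory GRing.Theory Num.Theory.
Import numFieldNormedType.Exports.

Local Open Scope classical_set_scope.
Local Open Scope ring_scope.
Local Open Scope complex_scope.

(** The extra index 0, with m_0 = z and s_{k,0} = 1, turns the equation of
    row k into sum_j s_{k,j} m_k m_j = -1 with j from 0 to n + 1 - k.  As z
    tends to 0 the two outermost antidiagonals dominate: products with
    j + k = n + 1 tend to constants, while those with j + k = n all have the
    same size.  The only power laws |m_k| ~ |z|^(a_k) compatible with both
    facts are a_k = (n + 1 - 2k) / (n + 1); the largest component is m_n, of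
    order |z|^(-(n-1)/(n+1)).

    To make this rigorous, write z = i w and m_k = i w^(a_k) c_k u_k, with the
    principal logarithm of w on the closed right half-plane, and
    e = w^(2/(n+1)).  The equations become polynomial in (e, u): their
    coefficients are nonnegative powers of e ([rescaled_dyson]).  At e = 0 only
    the outermost antidiagonal survives, which is degenerate, but the
    difference of the equations of rows k and n + 1 - k is divisible by e, and
    the quotient supplies the missing equations.  A suitable positive c
    ([leading_profile]) makes u = 1 the solution at e = 0.  The linearization
    there is h |-> 2 h_k + h_{n-k} - h_{k-1}; on its kernel h is antisymmetric,
    which turns the equations into those of a discrete Dirichlet Laplacian, so
    it is invertible ([coupling_mx_unit]).  A contraction argument
    ([implicit_function]) then yields a Lipschitz family u(e) of solutions for
    small complex e with u(0) = 1 ([rescaled_branch]).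

    For z in the closed upper half-plane, w^(a_k) has argument at most
    (n-1)/(n+1) * pi/2 in absolute value, so m_k = i w^(a_k) c_k u_k(e) lies in
    the upper half-plane.  Solutions there are unique ([dyson_unique]), hence
    this explicit family is the given solution.  It extends continuously to real
    z = E <> 0, so the density at E is (1/(pi n)) sum_k Re (w^(a_k) c_k u_k)
    at w = - i E, and the term k = n gives the limit
    c_n cos ((n-1)/(n+1) * pi/2) / (pi n) > 0 ([dos_asymptotics]). *)

(** * Real-valued modulus of complex numbers *)
Section Modulus.
Variable R : realType.
Implicit Types (x y z : R[i]) (a b : R).

(** The canonical norm of [R[i]] takes its values in [R[i]]; this one is
    real-valued, as the estimates below compare moduli with real numbers. *)
Definition cabs z : R := ComplexField.Normc.normc z.

Lemma cabs_ge0 z : 0 <= cabs z. Proof. by case: z => a b; exact: sqrtr_ge0. Qed.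
Lemma cabs0 : cabs 0 = 0. Proof. exact: ComplexField.Normc.normc0. Qed.
Lemma cabs1 : cabs 1 = 1. Proof. exact: ComplexField.Normc.normc1. Qed.
Lemma cabs_eq0 z : (cabs z == 0) = (z == 0).
Proof.
apply/eqP/eqP => [|->]; [exact: ComplexField.Normc.eq0_normc|exact: cabs0].
Qed.
Lemma cabsM y z : cabs (y * z) = cabs y * cabs z.
Proof. exact: ComplexField.Normc.normcM. Qed.
Lemma cabsD y z : cabs (y + z) <= cabs y + cabs z.
Proof. exact: le_normcD. Qed.
Lemma cabsN z : cabs (- z) = cabs z.
Proof. exact: normcN. Qed.
Lemma cabsB y z : cabs (y - z) = cabs (z - y).
Proof. by rewrite -cabsN opprB. Qed.
Lemma cabs_sum I (r : seq I) (P : pred I) (F : I -> R[i]) :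
  cabs (\sum_(i <- r | P i) F i) <= \sum_(i <- r | P i) cabs (F i).
Proof.
elim/big_ind2 : _ => [|x1 x2 y1 y2 h1 h2|//]; first by rewrite cabs0.
by rewrite (le_trans (cabsD _ _))// lerD.
Qed.
Lemma cabs_real a : cabs a%:C = `|a|.
Proof. by rewrite /cabs /= expr0n addr0 sqrtr_sqr. Qed.
Lemma normRe_cabs z : `|complex.Re z| <= cabs z.
Proof.
case: z => a b; rewrite /cabs /= -sqrtr_sqr ler_sqrt ?addr_ge0 ?sqr_ge0//.
by rewrite lerDl sqr_ge0.
Qed.
Lemma normIm_cabs z : `|complex.Im z| <= cabs z.
Proof.
case: z => a b; rewrite /cabs /= -sqrtr_sqr ler_sqrt ?addr_ge0 ?sqr_ge0//.
by rewrite lerDr sqr_ge0.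
Qed.
Lemma cabs_le_ReIm z : cabs z <= `|complex.Re z| + `|complex.Im z|.
Proof.
rewrite [z in cabs z]complexE (le_trans (cabsD _ _))// cabsM !cabs_real.
by rewrite /cabs /= expr0n expr1n add0r sqrtr1 mul1r.
Qed.

End Modulus.
#[global] Arguments cabs : simpl never.
(* A pattern with holes for the ordered structure: the inequality occurs below
   with syntactically different canonical instances on R. *)
#[global] Hint Extern 0 (is_true (@Order.le _ _ _ (@cabs _ _))) =>
  exact: cabs_ge0 : core.

(** * A fixed point theorem for complex column vectors *)
HB.instance Definition _ (R : realType) (m p : nat) := Complete.on 'M[R]_(m, p).

Section FixedPoint.
Variables (R : realType) (n : nat).
Local Notation V := 'cV[R[i]]_n.+1.
Local Notation W := 'M[R]_(n.+1, 2).
Implicit Types (h : V) (M : W) (r d : R).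

Definition cball r h := forall k, cabs (h k 0) <= r.

(* Banach's theorem is applied on real two-column matrices, a complete normed
   space, whose columns hold the real and imaginary parts. *)
Let cv M : V := \col_k (M k ord0 +i* M k ord_max).
Let vc h : W := \matrix_(k, j) if j == ord0 then complex.Re (h k 0) else complex.Im (h k 0).

Let vcK h : cv (vc h) = h.
Proof. by apply/colP => k; rewrite !mxE/=; case: (h k 0). Qed.
Let cvK M : vc (cv M) = M.
Proof.
apply/matrixP => k j; rewrite !mxE/=; case: ifPn => [/eqP ->//|j0].
by congr (M k _); apply: val_inj => /=; case: j j0 => [[|[|]]].
Qed.
Let vcB h h' : vc h - vc h' = vc (h - h').
Proof. 
by apply/matrixP => k j; rewrite !mxE; case: ifP; case: (h k 0); case: (h' k 0).
Qed.

Lemma mxnorm_le (m p : nat) (M : 'M[R]_(m.+1, p.+1)) r : 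
  `|M| <= r <-> forall i j, `|M i j| <= r.
Proof.
split=> [Mr i j|H].
  apply: le_trans Mr.
  by rewrite [leRHS]/Num.norm /= mx_normrE; apply/bigmax_geP; right => /=; exists (i, j).
rewrite [leLHS]/Num.norm /= mx_normrE; apply/bigmax_leP; split => //.
by rewrite (le_trans _ (H ord0 ord0)).
Qed.

Let vc_le h r : (forall k, cabs (h k 0) <= r) -> `|vc h| <= r.
Proof.
move=> H; apply/mxnorm_le => k j; rewrite mxE; apply: le_trans (H k).
by case: ifP => _; [exact: normRe_cabs|exact: normIm_cabs].
Qed.
Let vc_ge h r : `|vc h| <= r -> cball (r *+ 2) h.
Proof.
move=> /mxnorm_le H k; rewrite (le_trans (cabs_le_ReIm _))// mulr2n lerD//.
  by have := H k ord0; rewrite mxE.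
by have := H k ord_max; rewrite mxE.
Qed.

(** The sup norm on real and imaginary parts and the sup of the moduli agree up
    to a factor 2; it is absorbed by the two radii and by the contraction
    constant 1/4, which becomes 1/2. *)
Lemma cvec_fixed_point (Phi : V -> V) r : 0 <= r ->
  (forall h, cball (r *+ 2) h -> cball r (Phi h)) ->
  (forall h h' d, cball (r *+ 2) h -> cball (r *+ 2) h' -> cball d (h - h') ->
     cball (d / 4) (Phi h - Phi h')) ->
  exists2 h, cball (r *+ 2) h & Phi h = h.
Proof.
move=> r0 Phir PhiL.
pose U : set W := [set M | `|M| <= r].
pose f (M : W) : W := vc (Phi (cv M)).
have fU : set_fun U U f.
  move=> M /= MU; rewrite /U/f/=; apply: vc_le; apply: Phir.
  by apply: vc_ge; rewrite cvK.
pose F : {fun U >-> U} := HB.pack f (isFun.Build _ _ U U f fU).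
have [|||M MU Mf] := @banach_fixed_point R W U F.
- exists (2^-1)%:nng; split => [/=|]; first by lra.
  move=> [M M'] [/= MU M'U]; rewrite /f vcB.
  have dd : cball (`|M - M'| *+ 2) (cv M - cv M').
    by apply: vc_ge; rewrite -vcB !cvK.
  have H := PhiL _ _ _ (vc_ge (h := cv M) _) (vc_ge (h := cv M') _) dd.
  rewrite !cvK in H.
  apply: vc_le => k; apply: le_trans (H MU M'U k) _.
  by rewrite -mulr_natr; lra.
- have -> : U = (@Num.norm R W) @^-1` [set x | x <= r] by [].
  apply: closed_comp; last exact: closed_le.
  by move=> x _; exact: norm_continuous.
- by exists 0; rewrite /U/= normr0.
exists (cv M); first by apply: vc_ge; rewrite cvK.
by rewrite -[LHS]vcK -/(f M) {2}Mf.
Qed.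

End FixedPoint.

(** * An implicit function theorem with a linear leading part *)
Section Lipschitz.
Variables (R : realType) (n : nat).
Local Notation V := 'cV[R[i]]_n.+1.
Implicit Types (F G : R[i] -> V -> R[i]) (e : R[i]) (h : V).

(** Boundedness is included so that the class is closed under products, hence
    contains all polynomials in the parameter and the coordinates. *)
Definition disc_lipschitz F := exists2 K : R, 0 <= K &
  forall e h e' h' (d : R), cabs e <= 1 -> cball 1 h -> cabs e' <= 1 ->
    cball 1 h' -> cabs (e - e') <= d -> cball d (h - h') ->
  cabs (F e h) <= K /\ cabs (F e h - F e' h') <= K * d.

Lemma disc_lipschitz_cst (z : R[i]) : disc_lipschitz (fun _ _ => z).
Proof.
exists (cabs z) => // e h e' h' d _ _ _ _ /(le_trans (cabs_ge0 _)) d0 _.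
split; first exact: lexx.
by rewrite subrr cabs0 mulr_ge0.
Qed.

Lemma disc_lipschitz_param : disc_lipschitz (fun e _ => e).
Proof. by exists 1 => // e h e' h' d e1 _ _ _ ee _; rewrite mul1r. Qed.

Lemma disc_lipschitz_coord k : disc_lipschitz (fun _ h => h k 0).
Proof.
exists 1 => // e h e' h' d _ h1 _ _ _ hh; rewrite mul1r; split => //.
by have := hh k; rewrite !mxE.
Qed.

Lemma disc_lipschitzD F G : disc_lipschitz F -> disc_lipschitz G ->
  disc_lipschitz (fun e h => F e h + G e h).
Proof.
move=> [K K0 FK] [L L0 GL]; exists (K + L); first exact: addr_ge0.
move=> e h e' h' d e1 h1 e1' h1' ee hh.
have [F1 F2] := FK _ _ _ _ _ e1 h1 e1' h1' ee hh.
have [G1 G2] := GL _ _ _ _ _ e1 h1 e1' h1' ee hh.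
split; first by rewrite (le_trans (cabsD _ _))// lerD.
by rewrite opprD addrACA (le_trans (cabsD _ _))// mulrDl lerD.
Qed.

Lemma disc_lipschitzM F G : disc_lipschitz F -> disc_lipschitz G ->
  disc_lipschitz (fun e h => F e h * G e h).
Proof.
move=> [K K0 FK] [L L0 GL]; exists (K * L *+ 2); first by rewrite mulrn_wge0 ?mulr_ge0.
move=> e h e' h' d e1 h1 e1' h1' ee hh.
have [F1 F2] := FK _ _ _ _ _ e1 h1 e1' h1' ee hh.
have [G1 G2] := GL _ _ _ _ _ e1 h1 e1' h1' ee hh.
have ee' : cabs (e' - e) <= d by rewrite cabsB.
have hh' : cball d (h' - h) by move=> k; have := hh k; rewrite !mxE cabsB.
have [G3 _] := GL _ _ _ _ _ e1' h1' e1 h1 ee' hh'.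
have KL : 0 <= K * L by rewrite mulr_ge0.
split; first by rewrite cabsM (le_trans (ler_pM _ _ F1 G1))// mulr2n lerDl.
have -> : F e h * G e h - F e' h' * G e' h' =
    F e h * (G e h - G e' h') + (F e h - F e' h') * G e' h' by ring.
rewrite (le_trans (cabsD _ _))// !cabsM mulr2n mulrDl lerD//.
  by rewrite -mulrA ler_pM.
by rewrite mulrAC ler_pM.
Qed.

Lemma disc_lipschitz_eq F G : (forall e h, F e h = G e h) -> disc_lipschitz F -> disc_lipschitz G.
Proof. by move=> FG [K K0 FK]; exists K => // *; rewrite -!FG; exact: FK. Qed.

Lemma disc_lipschitzX F j : disc_lipschitz F -> disc_lipschitz (fun e h => F e h ^+ j).
Proof.
move=> HF; elim: j => [|j ih]; first by apply: (disc_lipschitz_eq _ (disc_lipschitz_cst 1)).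
by apply: (disc_lipschitz_eq _ (disc_lipschitzM HF ih)) => e h; rewrite exprS.
Qed.

Lemma disc_lipschitz_sum I (r : seq I) (F : I -> R[i] -> V -> R[i]) :
  (forall i, disc_lipschitz (F i)) -> disc_lipschitz (fun e h => \sum_(i <- r) F i e h).
Proof.
move=> HF; elim: r => [|i r ih].
  by apply: (disc_lipschitz_eq _ (disc_lipschitz_cst 0)) => e h; rewrite big_nil.
by apply: (disc_lipschitz_eq _ (disc_lipschitzD (HF i) ih)) => e h; rewrite big_cons.
Qed.

(** Functions that can be a remainder in an implicit function theorem at the
    origin: on the polydisc of radius r, the Lipschitz constant in h is O(r),
    while that in the parameter is merely O(1). *)
Definition flat_at0 F := exists2 K : R, 0 <= K &
  forall (r : R) e h e' h' (d t : R), r <= 1 ->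
    cabs e <= r -> cball r h -> cabs e' <= r -> cball r h' ->
    cabs (e - e') <= t -> cball d (h - h') ->
  cabs (F e h - F e' h') <= K * (r * d + t).

Lemma flat_at0D F G : flat_at0 F -> flat_at0 G -> flat_at0 (fun e h => F e h + G e h).
Proof.
move=> [K K0 FK] [L L0 GL]; exists (K + L); first exact: addr_ge0.
move=> r e h e' h' d t r1 e1 h1 e1' h1' ee hh.
have F2 := FK _ _ _ _ _ _ _ r1 e1 h1 e1' h1' ee hh.
have G2 := GL _ _ _ _ _ _ _ r1 e1 h1 e1' h1' ee hh.
by rewrite opprD addrACA (le_trans (cabsD _ _))// mulrDl lerD.
Qed.

Lemma flat_at0N F : flat_at0 F -> flat_at0 (fun e h => - F e h).
Proof.
move=> [K K0 FK]; exists K => // *; rewrite -opprD cabsN; exact: FK.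
Qed.

Lemma flat_at0_quad j k : flat_at0 (fun _ h => h j 0 * h k 0).
Proof.
exists 2 => // r e h e' h' d t r1 e1 h1 e1' h1' /(le_trans (cabs_ge0 _)) t0 hh.
have -> : h j 0 * h k 0 - h' j 0 * h' k 0 =
    h j 0 * (h k 0 - h' k 0) + (h j 0 - h' j 0) * h' k 0 by ring.
have hj : cabs (h j 0 - h' j 0) <= d by have := hh j; rewrite !mxE.
have hk : cabs (h k 0 - h' k 0) <= d by have := hh k; rewrite !mxE.
rewrite (le_trans (cabsD _ _))// !cabsM (le_trans (lerD (ler_pM _ _ (h1 j) hk)
  (ler_pM _ _ hj (h1' k))))//; lra.
Qed.

Lemma flat_at0_param F : disc_lipschitz F -> flat_at0 (fun e h => e * F e h).
Proof.
move=> [K K0 FK]; exists (K *+ 2); first by rewrite mulrn_wge0.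
move=> r e h e' h' d t r1 e1 h1 e1' h1' ee hh.
have t0 := le_trans (cabs_ge0 _) ee.
have d0 := le_trans (cabs_ge0 _) (hh ord0).
have r0 := le_trans (cabs_ge0 _) e1.
have h1w : cball 1 h by move=> k; exact: le_trans (h1 k) r1.
have h1w' : cball 1 h' by move=> k; exact: le_trans (h1' k) r1.
have ee1 : cabs (e - e') <= d + t by rewrite (le_trans ee)// lerDr.
have hh1 : cball (d + t) (h - h') by move=> k; rewrite (le_trans (hh k))// lerDl.
have [F1 F2] := FK _ _ _ _ _ (le_trans e1 r1) h1w (le_trans e1' r1) h1w' ee1 hh1.
have -> : e * F e h - e' * F e' h' = (e - e') * F e h + e' * (F e h - F e' h') by ring.
rewrite (le_trans (cabsD _ _))// !cabsM (le_trans (lerD (ler_pM _ _ ee F1)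
  (ler_pM _ _ e1' F2)))//.
have : r * (K * t) <= K * t by rewrite ler_piMl ?mulr_ge0.
have : 0 <= K * (r * d) by rewrite !mulr_ge0.
rewrite -mulr_natr; lra.
Qed.

End Lipschitz.

Section ImplicitFunction.
Variables (R : realType) (n : nat).
Local Notation V := 'cV[R[i]]_n.+1.
Variables (L : 'M[R[i]]_n.+1) (N : 'I_n.+1 -> R[i] -> V -> R[i]).
Hypothesis Lunit : L \in unitmx.
Hypothesis N_flat : forall k, flat_at0 (N k).
Hypothesis N00 : forall k, N k 0 0 = 0.

Let N_uniform : exists2 K : R, 0 <= K & forall k (r : R) e h e' h' (d t : R), r <= 1 ->
    cabs e <= r -> cball r h -> cabs e' <= r -> cball r h' ->
    cabs (e - e') <= t -> cball d (h - h') ->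
  cabs (N k e h - N k e' h') <= K * (r * d + t).
Proof.
have /choice[K HK] : forall k, exists K, 0 <= K /\ forall (r : R) e h e' h' (d t : R), r <= 1 ->
    cabs e <= r -> cball r h -> cabs e' <= r -> cball r h' ->
    cabs (e - e') <= t -> cball d (h - h') ->
  cabs (N k e h - N k e' h') <= K * (r * d + t).
  by move=> k; have [K K0 H] := N_flat k; exists K.
exists (\sum_k K k); first by apply: sumr_ge0 => k _; exact: (HK k).1.
move=> k r e h e' h' d t r1 e1 h1 e1' h1' ee hh.
apply: le_trans ((HK k).2 _ _ _ _ _ _ _ r1 e1 h1 e1' h1' ee hh) _.
have t0 := le_trans (cabs_ge0 _) ee.
have d0 := le_trans (cabs_ge0 _) (hh ord0).
have r0 := le_trans (cabs_ge0 _) e1.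
have KS : K k <= \sum_j K j.
  by rewrite (bigD1 k)//= lerDl; apply: sumr_ge0 => j _; exact: (HK j).1.
by rewrite ler_wpM2r// addr_ge0// mulr_ge0.
Qed.

(* The solutions of L h + N(e, h) = 0 are the fixed points of Phi e. *)
Let Phi (e : R[i]) (h : V) : V := - (invmx L *m (\col_k N k e h)).

Let Phi_lip : exists2 K : R, 0 < K & forall (r : R) e h e' h' (d t : R), r <= 1 ->
    cabs e <= r -> cball r h -> cabs e' <= r -> cball r h' ->
    cabs (e - e') <= t -> cball d (h - h') ->
  cball (K * (r * d + t)) (Phi e h - Phi e' h').
Proof.
have [K K0 NK] := N_uniform.
pose B := \sum_i \sum_j cabs (invmx L i j).
have B0 : 0 <= B by apply: sumr_ge0 => i _; apply: sumr_ge0.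
exists (B * K + 1); first by rewrite ltr_wpDl ?mulr_ge0.
move=> r e h e' h' d t r1 e1 h1 e1' h1' ee hh k.
have t0 := le_trans (cabs_ge0 _) ee.
have d0 := le_trans (cabs_ge0 _) (hh ord0).
have r0 := le_trans (cabs_ge0 _) e1.
have rdt : 0 <= r * d + t by rewrite addr_ge0 ?mulr_ge0.
rewrite /Phi -opprD -mulmxBr !mxE cabsN (le_trans (cabs_sum _ _ _))//.
rewrite (@le_trans _ _ (\sum_j cabs (invmx L k j) * (K * (r * d + t))))//.
  apply: ler_sum => j _; rewrite cabsM ler_wpM2l// !mxE.
  exact: NK.
rewrite -mulr_suml mulrA ler_wpM2r//.
rewrite (@le_trans _ _ (B * K)) ?lerDl// ler_wpM2r// /B [leRHS](bigD1 k)//= lerDl.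
by apply: sumr_ge0 => i _; apply: sumr_ge0.
Qed.

Let PhiP e h : Phi e h = h -> forall k, (L *m h) k 0 + N k e h = 0.
Proof.
move=> H k; rewrite -{1}H /Phi mulmxN mulmxA mulmxV// mul1mx !mxE addNr//.
Qed.

Let Phi00 : Phi 0 0 = 0.
Proof.
rewrite /Phi (_ : \col_k _ = 0) ?mulmx0 ?oppr0//.
by apply/colP => k; rewrite !mxE.
Qed.

Let cballE (d : R) (h : V) : (forall k, cabs (h k 0) <= d) -> cball d h.
Proof. by []. Qed.

(** For a small radius r the map h |-> - L^-1 N(e, h) is a contraction of the
    polydisc of radius r, and for e small compared with r it preserves the
    polydisc.  Lipschitz dependence on e follows from the contraction: the
    distance d of two solutions satisfies d <= d/4 + K |e - e'|. *)
Theorem implicit_function (r0 : R) : 0 < r0 -> 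
  exists (delta B : R) (h : R[i] -> V), [/\ 0 < delta, 0 < B, h 0 = 0,
    forall e, cabs e <= delta ->
      cball r0 (h e) /\ forall k, (L *m h e) k 0 + N k e (h e) = 0 &
    forall e e', cabs e <= delta -> cabs e' <= delta ->
      cball (B * cabs (e - e')) (h e - h e')].
Proof.
move=> r00; have [K K0 HK] := Phi_lip.
have [r [rp r1 rr0 rK]] : exists r : R, [/\ 0 < r, r <= 1, r <= r0 & K * r <= 1 / 4].
  exists (Num.min 1 (Num.min r0 (4 * K)^-1)); split.
  - by rewrite !lt_min ltr01 r00 invr_gt0 mulr_gt0.
  - by rewrite ge_min lexx.
  - by rewrite !ge_min lexx !orbT.
  - rewrite -ler_pdivlMl// !ge_min; apply/orP; right; apply/orP; right.
    by rewrite invfM mulrC div1r.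
pose delta := Num.min r (r / (4 * K)).
have dp : 0 < delta by rewrite /delta lt_min rp divr_gt0 ?mulr_gt0.
have dr : delta <= r by rewrite /delta ge_min lexx.
have dK : K * delta <= r / 4.
  rewrite -ler_pdivlMl// /delta ge_min; apply/orP; right.
  by rewrite (_ : r / (4 * K) = K^-1 * (r / 4)) ?lexx//; field; rewrite gt_eqF.
have c0 : cball r (0 : V) by move=> k; rewrite mxE cabs0 ltW.
have ce0 : cabs (0 : R[i]) <= r by rewrite cabs0 ltW.
have ex e : cabs e <= delta -> exists2 h, cball r h & Phi e h = h.
  move=> ed; have er := le_trans ed dr.
  have H2 : (r / 2) *+ 2 = r by rewrite -mulr_natr mulfVK.
  rewrite -H2; apply: cvec_fixed_point; rewrite ?H2 ?divr_ge0// ?(ltW rp)//.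
  - move=> h hr k.
    have hh0 : cball r (h - 0) by rewrite subr0.
    have ee0 : cabs (e - 0) <= delta by rewrite subr0.
    have := HK _ _ _ _ _ _ _ r1 er hr ce0 c0 ee0 hh0 k.
    rewrite Phi00 subr0 => /le_trans; apply.
    have : K * r * r <= 1 / 4 * r by rewrite ler_wpM2r// ltW.
    lra.
  - move=> h h' d hr hr' hh k.
    have ee0 : cabs (e - e) <= 0 by rewrite subrr cabs0.
    apply: le_trans (HK _ _ _ _ _ _ _ r1 er hr er hr' ee0 hh k) _.
    have d0 := le_trans (cabs_ge0 _) (hh ord0).
    have : K * r * d <= 1 / 4 * d by rewrite ler_wpM2r.
    lra.
have lip e e' h h' : cabs e <= delta -> cabs e' <= delta -> cball r h -> cball r h' ->
    Phi e h = h -> Phi e' h' = h' -> cball (2 * K * cabs (e - e')) (h - h').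
  move=> ed ed' hr hr' Ph Ph'.
  pose d := \big[Num.max/0]_k cabs ((h - h') k 0).
  have hd : cball d (h - h') by move=> k; exact: le_bigmax.
  have d0 : 0 <= d by exact: bigmax_ge_id.
  have H := HK _ _ _ _ _ _ _ r1 (le_trans ed dr) hr (le_trans ed' dr) hr' (lexx _) hd.
  rewrite Ph Ph' in H.
  have dd : d <= K * (r * d + cabs (e - e')).
    apply/bigmax_leP; split => [|k _]; last exact: H.
    by rewrite mulr_ge0 ?addr_ge0 ?mulr_ge0// ltW.
  have : K * r * d <= 1 / 4 * d by rewrite ler_wpM2r.
  move=> dd' k; apply: le_trans (hd k) _.
  have : 0 <= K * cabs (e - e') by rewrite mulr_ge0// ltW.
  lra.
have /choice[h hP] : forall e, exists h, cabs e <= delta -> cball r h /\ Phi e h = h.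
  move=> e; have [ed|_] := leP (cabs e) delta; last by exists 0.
  by have [h ? ?] := ex e ed; exists h.
have d00 : cabs (0 : R[i]) <= delta by rewrite cabs0 ltW.
exists delta, (2 * K), h; split => //; first by rewrite mulr_gt0.
- have [h0 P0] := hP 0 d00.
  have := lip _ _ _ _ d00 d00 h0 c0 P0 Phi00; rewrite subrr cabs0 mulr0 => H.
  apply/colP => k; have := H k; rewrite !mxE subr0 => ?.
  by apply/eqP; rewrite -cabs_eq0 eq_le cabs_ge0 andbT.
- move=> e ed; have [he Pe] := hP e ed; split; last exact: PhiP.
  by move=> k; exact: le_trans (he k) rr0.
- move=> e e' ed ed'; have [he Pe] := hP e ed; have [he' Pe'] := hP e' ed'.
  exact: lip.
Qed.

End ImplicitFunction.

(** * The linearized system and the leading-order profile *)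
Section Coupling.
Variables (F : numFieldType) (n : nat).

(** The matrix of h |-> 2 h_k + h_{n-k} - h_{k-1}, with the boundary condition
    h_0 = 0 as row 0.  It is the sum of the map h_k + h_{n+1-k}, symmetric under
    k |-> n + 1 - k, and of the antisymmetric map
    (h_k + h_{n-k}) - (h_{n+1-k} + h_{k-1}), so that one system encodes both
    families of linearized equations. *)
Definition coupling_mx : 'M[F]_n.+1 := \matrix_(k, j)
  if k == 0%N :> nat then (j == 0%N :> nat)%:R
  else 2 * (j == k :> nat)%:R + (j == n - k :> nat)%N%:R - (j == k.-1 :> nat)%:R.

Lemma sum_indicator (h : 'cV[F]_n.+1) a : (a <= n)%N ->
  \sum_(j < n.+1) (j == a :> nat)%:R * h j 0 = h (inord a) 0.
Proof.
move=> an; rewrite (bigD1 (inord a))//= inordK ?ltnS// eqxx mul1r big1 ?addr0//.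
move=> j ja; case: eqP => [ja'|]; last by rewrite mul0r.
by move: ja; rewrite -ja' inord_val eqxx.
Qed.

Lemma coupling_mx0 (h : 'cV[F]_n.+1) : (coupling_mx *m h) (inord 0) 0 = h (inord 0) 0.
Proof.
rewrite mxE -sum_indicator//; apply: eq_bigr => j _.
by rewrite mxE inordK// eqxx.
Qed.

Lemma coupling_mxS (h : 'cV[F]_n.+1) k : (0 < k <= n)%N ->
  (coupling_mx *m h) (inord k) 0 =
  2 * h (inord k) 0 + h (inord (n - k)) 0 - h (inord k.-1) 0.
Proof.
move=> /andP[k0 kn]; rewrite mxE.
rewrite -[h (inord k) 0]sum_indicator// -[h (inord (n - k)) 0]sum_indicator ?leq_subr//.
rewrite -[h (inord k.-1) 0]sum_indicator ?(leq_trans (leq_pred _))//.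
rewrite mulr_sumr -big_split/= -sumrB; apply: eq_bigr => j _.
by rewrite mxE inordK// gtn_eqF// mulrBl mulrDl mulrA.
Qed.

(** Antisymmetry turns y_{n-k} into - y_{k+1}, so y is discrete harmonic, hence
    linear; the last equation, at k = n, forces the slope to vanish. *)
Lemma antisym_discrete_harmonic0 (y : nat -> F) : y 0%N = 0 ->
  (forall k, (0 < k <= n)%N -> y (n.+1 - k)%N = - y k) ->
  (forall k, (0 < k <= n)%N -> 2 * y k + y (n - k)%N - y k.-1 = 0) ->
  forall k, (k <= n)%N -> y k = 0.
Proof.
move=> y0 anti eqn.
have lap k : (0 < k < n)%N -> y k.+1 = 2 * y k - y k.-1.
  move=> /andP[k0 kn]; have := eqn k; rewrite k0 (ltnW kn) => /(_ isT).
  have := anti k.+1; rewrite kn subSS => /(_ isT) ->.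
  by move=> /eqP; rewrite addrAC subr_eq0 => /eqP <-.
have lin k : (k < n)%N -> y k = k%:R * y 1%N /\ y k.+1 = k.+1%:R * y 1%N.
  elim: k => [|k ih] kn; first by rewrite y0 mul0r mul1r.
  have [yk yk1] := ih (ltnW kn); split => //.
  rewrite lap ?kn// yk yk1/= -[in RHS]natr1 -[in RHS]natr1 -[in LHS]natr1; ring.
have y1 : (0 < n)%N -> y 1%N = 0.
  move=> n0; have := eqn n; rewrite n0 leqnn subnn y0 => /(_ isT).
  have [_] := lin n.-1 ltac:(by rewrite prednK).
  have [-> _] := lin n.-1 ltac:(by rewrite prednK).
  rewrite prednK// => ->.
  rewrite addr0 mulrA -mulrBl -{1}(prednK n0) => /eqP; rewrite mulf_eq0 => /orP[|/eqP//].
  rewrite -natrM -natrB ?pnatr_eq0; last by lia.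
  by move=> /eqP; lia.
case=> [//|k] kn; have [_ ->] := lin k kn.
by rewrite y1 ?mulr0//; lia.
Qed.

(** A kernel vector is antisymmetric under k |-> n + 1 - k: the sum of the rows
    k and n + 1 - k of the system is 2 (h_k + h_{n+1-k}). *)
Lemma coupling_mx_unit : coupling_mx \in unitmx.
Proof.
rewrite -unitmx_tr -row_free_unit; apply: inj_row_free => v /(congr1 trmx).
rewrite trmx_mul trmxK trmx0; move: v^T (trmxK v) => h <- Lh.
rewrite (_ : h = 0) ?trmx0//.
have h0 : h (inord 0) 0 = 0 by rewrite -coupling_mx0 Lh mxE.
have hS k : (0 < k <= n)%N -> 2 * h (inord k) 0 + h (inord (n - k)) 0 - h (inord k.-1) 0 = 0.
  by move=> kn; rewrite -coupling_mxS// Lh mxE.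
have anti k : (0 < k <= n)%N -> h (inord (n.+1 - k)) 0 = - h (inord k) 0.
  move=> /andP[k0 kn]; have := hS k; have := hS (n.+1 - k)%N.
  rewrite (_ : n - (n.+1 - k) = k.-1)%N; last lia.
  rewrite (_ : (n.+1 - k).-1 = n - k)%N; last lia.
  have -> : (0 < n.+1 - k <= n)%N by lia.
  rewrite k0 kn => /(_ isT) e1 /(_ isT) e2.
  have /eqP : 2 * (h (inord (n.+1 - k)) 0 + h (inord k) 0) = 0.
    by have := congr2 +%R e1 e2; rewrite addr0 => <-; ring.
  by rewrite mulf_eq0 pnatr_eq0/= addr_eq0 => /eqP.
apply/colP => k; rewrite mxE -(inord_val k).
apply: (@antisym_discrete_harmonic0 (fun k => h (inord k) 0)) => //.
by rewrite -ltnS.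
Qed.

Lemma coupling_solve (b : nat -> F) : exists2 y : nat -> F, y 0%N = 0 &
  forall k, (0 < k <= n)%N -> 2 * y k + y (n - k)%N - y k.-1 = b k.
Proof.
pose v : 'cV_n.+1 := \col_k if k == 0%N :> nat then 0 else b k.
pose h := invmx coupling_mx *m v.
have Lh : coupling_mx *m h = v by rewrite mulmxA mulmxV ?coupling_mx_unit// mul1mx.
exists (fun k => h (inord k) 0) => [|k kn].
  by rewrite -coupling_mx0 Lh mxE inordK.
rewrite -coupling_mxS// Lh mxE inordK; last by case/andP: kn.
by case/andP: kn => /gtn_eqF ->.
Qed.

End Coupling.

Section LeadingProfile.
Variables (R : realType) (n : nat) (s : nat -> nat -> R).
Hypothesis s_sym : forall j k, s j k = s k j.
Hypothesis s_n : forall k, (k <= n)%N -> 0 < s k (n - k).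
Hypothesis s_n1 : forall k, (0 < k <= n)%N -> 0 < s k (n.+1 - k).

(** The equations satisfied by c at leading order.  In logarithmic coordinates
    they are linear with the matrix [coupling_mx]; the second family says that
    the products over the antidiagonal k + j = n are all equal, and is obtained
    by comparing consecutive products. *)
Lemma leading_profile : exists (c : nat -> R) (kappa : R),
  [/\ c 0%N = 1, forall k, 0 < c k, 0 < kappa,
    forall k, (0 < k <= n)%N -> s k (n.+1 - k) * c k * c (n.+1 - k)%N = 1 &
    forall k, (k <= n)%N -> s k (n - k) * c k * c (n - k)%N = kappa].
Proof.
pose l j k := ln (s j k).
have l_sym j k : l j k = l k j by rewrite /l s_sym.
have [y y0 yE] := coupling_solve n (fun k =>
  - l k (n.+1 - k)%N - l k (n - k)%N + l (n.+1 - k)%N k.-1).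
pose p k := l k (n.+1 - k)%N + y k + y (n.+1 - k)%N.
pose q k := l k (n - k)%N + y k + y (n - k)%N.
have pq k : (0 < k <= n)%N -> p k = 0 /\ q k = q k.-1.
  move=> kn; have := yE k kn.
  have := yE (n.+1 - k)%N ltac:(lia); rewrite /p /q.
  rewrite (_ : n - k.-1 = n.+1 - k)%N; last lia.
  rewrite (_ : n.+1 - (n.+1 - k) = k)%N; last lia.
  rewrite (_ : n - (n.+1 - k) = k.-1)%N; last lia.
  rewrite (_ : (n.+1 - k).-1 = n - k)%N; last lia.
  rewrite (l_sym (n.+1 - k)%N k) (l_sym (n.+1 - k)%N k.-1).
  by move=> e1 e2; split; lra.
have qE k : (k <= n)%N -> q k = q 0%N.
  elim: k => // k ih kn; have [_ ->] := pq k.+1 kn.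
  by rewrite ih// ltnW.
exists (fun k => expR (y k)), (expR (q 0%N)); split.
- by rewrite y0 expR0.
- by move=> k; exact: expR_gt0.
- exact: expR_gt0.
- move=> k kn; rewrite -{1}[s k _]lnK ?posrE ?s_n1//.
  by rewrite -!expRD -/(l _ _) -/(p k) (pq k kn).1 expR0.
- move=> k kn; rewrite -{1}[s k _]lnK ?posrE ?s_n//.
  by rewrite -!expRD -/(l _ _) -/(q k) qE.
Qed.

End LeadingProfile.

(** * Solutions of the rescaled equations *)
Section RescaledBranch.
Variables (R : realType) (n : nat) (s : nat -> nat -> R).
Hypothesis s_sym : forall j k, s j k = s k j.
Hypothesis s_n : forall k, (k <= n)%N -> 0 < s k (n - k).
Hypothesis s_n1 : forall k, (0 < k <= n)%N -> 0 < s k (n.+1 - k).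

Local Notation V := 'cV[R[i]]_n.+1.

(** Row k of the Dyson equation after the substitution
    m_k = i w^(a_k) c_k u_k, where e = w^(2/(n+1)); the summand j = 0 comes from
    the term z. *)
Definition rescaled_dyson (c : nat -> R) (e : R[i]) (u : nat -> R[i]) :=
  forall k, (0 < k <= n)%N ->
    \sum_(j < n.+2 - k) e ^+ (n.+1 - k - j) * (s k j * c k * c j)%:C * u k * u j = 1.

(** Write P_k for the sum in row k and P_k = u_k u_{n+1-k} + e Q_k.  The
    equations P_k = 1 follow from the single family
    u_k u_{n+1-k} + e (Q_k + Q_{n+1-k}) / 2 - 1 + (Q_k - Q_{n+1-k}) / kappa = 0:
    exchanging k and n + 1 - k changes only the sign of the last term, so
    Q_k = Q_{n+1-k}.  Its linear part at u = 1 is [coupling_mx], and the rest is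
    flat because Q_k = kappa u_k u_{n-k} + e T_k. *)
Theorem rescaled_branch : exists2 c : nat -> R, c 0%N = 1 /\ (forall k, 0 < c k) &
  forall r0 : R, 0 < r0 -> exists (delta B : R) (u : R[i] -> nat -> R[i]),
  [/\ 0 < delta, 0 < B, forall k, u 0 k = 1,
    forall e, cabs e <= delta -> [/\ u e 0%N = 1, rescaled_dyson c e (u e) &
      forall k, cabs (u e k - 1) <= r0] &
    forall e e' k, cabs e <= delta -> cabs e' <= delta ->
      cabs (u e k - u e' k) <= B * cabs (e - e')].
Proof.
have [c [kappa [c0 cp kp c_n1 c_n]]] := leading_profile s_sym s_n s_n1.
exists c => // r0 r00.
pose K : R[i] := kappa%:C.
have K0 : K != 0 by rewrite eq_complex /= eqxx andbT gt_eqF.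
pose t k j : R[i] := (s k j * c k * c j)%:C.
pose y (h : V) k := h (inord k) 0.
pose x h k := 1 + y h k.
pose Q k e h := \sum_(j < n.+1 - k) e ^+ (n - k - j) * t k j * x h k * x h j.
pose T k e h := \sum_(j < n - k) e ^+ (n - k - j.+1) * t k j * x h k * x h j.
have QE k e h : (k <= n)%N -> Q k e h = K * x h k * x h (n - k)%N + e * T k e h.
  move=> kn; rewrite /Q subSn// big_ord_recr/= subnn expr0 mul1r /t c_n// addrC.
  congr (_ + _); rewrite mulr_sumr; apply: eq_bigr => j _.
  by rewrite -subSS subSn ?exprS ?mulrA//; case: j.
have PE k e h : (0 < k <= n)%N ->
    \sum_(j < n.+2 - k) e ^+ (n.+1 - k - j) * t k j * x h k * x h j =
    x h k * x h (n.+1 - k)%N + e * Q k e h.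
  move=> kn; rewrite subSn; last by case/andP: kn => _ /leqW.
  rewrite big_ord_recr/= subnn expr0 mul1r /t c_n1// mul1r addrC.
  congr (_ + _); rewrite /Q mulr_sumr; apply: eq_bigr => j _.
  rewrite (_ : n.+1 - k - j = (n - k - j).+1)%N ?exprS ?mulrA//.
  by have := ltn_ord j; lia.
have lx k : disc_lipschitz (fun _ h => x h k).
  by apply: disc_lipschitzD; [exact: disc_lipschitz_cst|exact: disc_lipschitz_coord].
have lS (m : nat) k (f : nat -> nat) :
    disc_lipschitz (fun e h => \sum_(j < m) e ^+ f j * t k j * x h k * x h j).
  apply: (@disc_lipschitz_sum _ _ _ _ (fun (j : 'I_m) e h => _)) => j.
  apply: disc_lipschitzM; last exact: lx.
  apply: disc_lipschitzM; last exact: lx.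
  apply: disc_lipschitzM; last exact: disc_lipschitz_cst.
  exact/disc_lipschitzX/disc_lipschitz_param.
have lQ k : disc_lipschitz (fun e h => Q k e h) := lS _ k (fun j => n - k - j)%N.
have lT k : disc_lipschitz (fun e h => T k e h) := lS _ k (fun j => n - k - j.+1)%N.
(* N k is what remains of that equation, at u = 1 + h, without its linear part. *)
pose N k e (h : V) : R[i] := if k == 0%N then 0 else
  y h k * y h (n.+1 - k)%N + (y h k * y h (n - k)%N - y h (n.+1 - k)%N * y h k.-1) +
  e * (2^-1 * (Q k e h + Q (n.+1 - k)%N e h)
       + K^-1 * (T k e h + (- 1) * T (n.+1 - k)%N e h)).
have N_flat k : flat_at0 (N k).
  rewrite /N; case: eqP => _.
    by exists 0 => // *; rewrite subrr cabs0 mul0r.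
  apply: flat_at0D; last first.
    apply: flat_at0_param; apply: disc_lipschitzD;
      (apply: disc_lipschitzM; first exact: disc_lipschitz_cst).
      exact: disc_lipschitzD.
    by apply: disc_lipschitzD => //; apply: disc_lipschitzM => //; exact: disc_lipschitz_cst.
  apply: flat_at0D; first exact: flat_at0_quad.
  by apply: flat_at0D; [exact: flat_at0_quad|apply: flat_at0N; exact: flat_at0_quad].
have N00 k : N k 0 0 = 0.
  by rewrite /N /y; case: eqP => // _; rewrite !mxE !mul0r subr0 !addr0.
have [delta [B [h [dp Bp h0 hE hL]]]] := implicit_function (coupling_mx_unit R[i] n)
  (fun k : 'I_n.+1 => N_flat k) (fun k : 'I_n.+1 => N00 k) r00.
exists delta, B, (fun e => x (h e)); split => //.
- by move=> k; rewrite /x /y h0 mxE addr0.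
- move=> e ed; have [hr hEe] := hE e ed; split.
  + have := hEe (inord 0); rewrite coupling_mx0 /N inordK// addr0 => E0.
    by rewrite /x /y E0 addr0.
  + have G k : (0 < k <= n)%N ->
      x (h e) k * x (h e) (n.+1 - k)%N + e * (2^-1 * (Q k e (h e) + Q (n.+1 - k)%N e (h e)))
      - 1 + K^-1 * (Q k e (h e) - Q (n.+1 - k)%N e (h e)) = 0.
      move=> kn; rewrite -(hEe (inord k)) coupling_mxS// /N inordK; last by case/andP: kn.
      rewrite gtn_eqF; last by case/andP: kn.
      rewrite -![h e (inord _) 0]/(y (h e) _).
      have Q1 := QE k e (h e) ltac:(lia).
      have Q2 := QE (n.+1 - k)%N e (h e) ltac:(lia).
      rewrite (_ : n - (n.+1 - k) = k.-1)%N in Q2; last lia.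
      rewrite [in X in K^-1 * X]Q1 [in X in K^-1 * X]Q2 /x.
      by field.
    move=> k kn; rewrite PE//.
    have G1 := G k kn; have := G (n.+1 - k)%N ltac:(lia).
    rewrite (_ : n.+1 - (n.+1 - k) = k)%N; last lia.
    move=> G2.
    have QQ : Q k e (h e) = Q (n.+1 - k)%N e (h e).
      apply/eqP; rewrite -subr_eq0; move: (congr2 (fun a b => a - b) G1 G2).
      rewrite subr0 => GG.
      have : 2 * K^-1 * (Q k e (h e) - Q (n.+1 - k)%N e (h e)) = 0 by rewrite -GG; ring.
      move=> /eqP; rewrite !mulf_eq0 invr_eq0 (negbTE K0) pnatr_eq0/=.
      by [].
    apply/eqP; rewrite -subr_eq0 -G1 -QQ; apply/eqP; field.
    by rewrite K0.
  + by move=> k; have := hr (inord k); rewrite /x /y addrC addKr.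
- move=> e e' k ed ed'; have := hL _ _ ed ed' (inord k).
  by rewrite /x /y !mxE opprD addrACA subrr add0r.
Qed.

End RescaledBranch.

(** * Uniqueness of the solution of the Dyson equation *)
Section Uniqueness.
Variables (R : realType) (n : nat) (S : 'M[R]_n).
Hypothesis S_ge0 : forall i j, 0 <= S i j.

Definition dyson_at (z : R[i]) (m : 'I_n -> R[i]) := forall k,
  upper_half_plane (m k) /\ - (m k)^-1 = z + \sum_(j < n) (S k j)%:C * m j.

Lemma cabs_sqr (z : R[i]) : cabs z ^+ 2 = complex.Re z ^+ 2 + complex.Im z ^+ 2.
Proof. by case: z => a b; rewrite sqr_sqrtr ?addr_ge0 ?sqr_ge0. Qed.

Lemma ImNV (z : R[i]) : complex.Im (- z^-1) = complex.Im z / cabs z ^+ 2.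
Proof. by rewrite cabs_sqr; case: z => a b /=; rewrite opprK. Qed.

Lemma Im_sum I (r : seq I) (F : I -> R[i]) :
  complex.Im (\sum_(i <- r) F i) = \sum_(i <- r) complex.Im (F i).
Proof. exact: (raddf_sum (@complex.Im R : Rcomplex R -> R)). Qed.

Lemma Im_realM (a : R) (z : R[i]) : complex.Im (a%:C * z) = a * complex.Im z.
Proof. by case: z => x y /=; rewrite mul0r addr0. Qed.

Lemma dyson_sum_Im_lt z m k : 0 < complex.Im z -> dyson_at z m ->
  \sum_j S k j * complex.Im (m j) < complex.Im (m k) / cabs (m k) ^+ 2.
Proof.
move=> z0 /(_ k)[_ /(congr1 (@complex.Im R))]; rewrite ImNV => ->.
have -> x y : complex.Im (x + y) = complex.Im x + complex.Im y :> R by case: x; case: y.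
rewrite Im_sum ltr_pwDl//; apply: ler_sum => j _.
by rewrite Im_realM.
Qed.

Lemma upper_half_plane_neq0 (z : R[i]) : upper_half_plane z -> z != 0.
Proof. by rewrite /upper_half_plane/=; apply: contraTneq => ->; rewrite ltxx. Qed.

Lemma dyson_diff z m m' k : dyson_at z m -> dyson_at z m' ->
  cabs (m k - m' k) <= cabs (m k) * cabs (m' k) * \sum_j S k j * cabs (m j - m' j).
Proof.
move=> Hm Hm'; have [/upper_half_plane_neq0 mk0 mk] := Hm k.
have [/upper_half_plane_neq0 mk0' mk'] := Hm' k.
have -> : m k - m' k = m k * m' k * \sum_j (S k j)%:C * (m j - m' j).
  have -> : \sum_j (S k j)%:C * (m j - m' j) = (- (m k)^-1) - (- (m' k)^-1).
    by under eq_bigr do rewrite mulrBr; rewrite sumrB mk mk'; ring.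
  by field; rewrite mk0 mk0'.
rewrite !cabsM ler_wpM2l ?mulr_ge0// (le_trans (cabs_sum _ _ _))//.
by apply: ler_sum => j _; rewrite cabsM cabs_real ger0_norm.
Qed.

(** The imaginary part of the equation gives sum_j s_{kj} v_j < v_k / |m_k|^2
    for v = Im m.  The geometric mean of the two solutions inherits such a bound
    by the inequality of arithmetic and geometric means, weighted so that it is
    an equality at index k. *)
Lemma dyson_geom_mean z m m' k : 0 < complex.Im z -> dyson_at z m -> dyson_at z m' ->
  cabs (m k) * cabs (m' k) *
    \sum_j S k j * (Num.sqrt (complex.Im (m j)) * Num.sqrt (complex.Im (m' j))) <
  Num.sqrt (complex.Im (m k)) * Num.sqrt (complex.Im (m' k)).
Proof.
move=> z0 Hm Hm'.
set p := fun j => Num.sqrt (complex.Im (m j)).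
set q := fun j => Num.sqrt (complex.Im (m' j)).
have pE j : complex.Im (m j) = p j ^+ 2 by rewrite sqr_sqrtr// ltW//; exact: (Hm j).1.
have qE j : complex.Im (m' j) = q j ^+ 2 by rewrite sqr_sqrtr// ltW//; exact: (Hm' j).1.
have pk : 0 < p k by rewrite sqrtr_gt0; exact: (Hm k).1.
have qk : 0 < q k by rewrite sqrtr_gt0; exact: (Hm' k).1.
have gk : 0 < cabs (m k).
  by rewrite lt_def cabs_ge0 cabs_eq0 (upper_half_plane_neq0 (Hm k).1).
have gk' : 0 < cabs (m' k).
  by rewrite lt_def cabs_ge0 cabs_eq0 (upper_half_plane_neq0 (Hm' k).1).
have X := dyson_sum_Im_lt k z0 Hm; have X' := dyson_sum_Im_lt k z0 Hm'.
rewrite pE in X; rewrite qE in X'.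
set g := cabs (m k) in gk X *; set g' := cabs (m' k) in gk' X' *.
(* The weight l balances l v_k / |m_k|^2 against l^-1 v'_k / |m'_k|^2. *)
pose l := q k / p k * (g / g').
have l0 : 0 < l by rewrite !mulr_gt0 ?invr_gt0.
have amgm j : S k j * (p j * q j) <=
    2^-1 * (l * (S k j * complex.Im (m j)) + l^-1 * (S k j * complex.Im (m' j))).
  rewrite pE qE.
  have -> : 2^-1 * (l * (S k j * p j ^+ 2) + l^-1 * (S k j * q j ^+ 2)) =
    S k j * (p j * q j) + 2^-1 * (S k j * l^-1 * (l * p j - q j) ^+ 2).
    by field; rewrite gt_eqF.
  by rewrite lerDl mulr_ge0// mulr_ge0 ?sqr_ge0// mulr_ge0// invr_ge0 ltW.
have SS : \sum_j S k j * (p j * q j) <= 2^-1 * (l * (\sum_j S k j * complex.Im (m j)) +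
    l^-1 * (\sum_j S k j * complex.Im (m' j))).
  rewrite !mulr_sumr -big_split/= mulr_sumr.
  by apply: ler_sum => j _; exact: amgm.
apply: le_lt_trans (ler_wpM2l _ SS) _; first by rewrite mulr_ge0 ?ltW.
rewrite -/(p k) -/(q k).
have -> : p k * q k = g * g' * (2^-1 * (l * (p k ^+ 2 / g ^+ 2) + l^-1 * (q k ^+ 2 / g' ^+ 2))).
  by rewrite /l; field; rewrite !gt_eqF.
by rewrite ltr_pM2l ?mulr_gt0// ltr_pM2l ?invr_gt0// ltrD// ltr_pM2l ?invr_gt0.
Qed.

(** By [dyson_geom_mean] the nonnegative matrix |m_k m'_k| s_{kj} strictly
    contracts the positive vector sqrt (Im m_j * Im m'_j), while by [dyson_diff]
    it does not decrease the vector |m_j - m'_j|.  Comparing both at an index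
    where their ratio is maximal shows that the difference vanishes. *)
Lemma dyson_unique z m m' : 0 < complex.Im z -> dyson_at z m -> dyson_at z m' ->
  m =1 m'.
Proof.
move=> z0 Hm Hm' i.
pose a j := Num.sqrt (complex.Im (m j)) * Num.sqrt (complex.Im (m' j)).
have a0 j : 0 < a j.
  by rewrite mulr_gt0// sqrtr_gt0; [exact: (Hm j).1|exact: (Hm' j).1].
pose d j := cabs (m j - m' j).
have [k _ kmax] := @arg_maxP _ _ _ i xpredT (fun j => d j / a j) isT.
have dk j : d j <= d k / a k * a j by rewrite -ler_pdivrMr//; exact: kmax.
have dk0 : d k <= 0.
  rewrite leNgt; apply/negP => dk0.
  have : d k < d k; last by rewrite ltxx.
  rewrite {1}/d (le_lt_trans (dyson_diff k Hm Hm'))//.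
  rewrite -[ltRHS](mulfVK (lt0r_neq0 (a0 k))).
  rewrite (@le_lt_trans _ _ (d k / a k * (cabs (m k) * cabs (m' k) * \sum_j S k j * a j)))//.
    rewrite mulrCA ler_wpM2l ?mulr_ge0// mulr_sumr.
    by apply: ler_sum => j _; rewrite mulrCA ler_wpM2l//; exact: dk.
  by rewrite ltr_pM2l ?divr_gt0//; exact: dyson_geom_mean z0 Hm Hm'.
have di : d i <= 0.
  by rewrite (le_trans (dk i))// pmulr_lle0// pmulr_lle0 ?invr_gt0.
by apply/eqP; rewrite -subr_eq0 -cabs_eq0 eq_le di cabs_ge0.
Qed.

End Uniqueness.

(** * Complex exponential and logarithm *)
Section ComplexLogarithm.
Variable R : realType.
Implicit Types (z w : R[i]) (a x y : R).

Definition cexp z : R[i] :=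
  (expR (complex.Re z) * cos (complex.Im z)) +i* (expR (complex.Re z) * sin (complex.Im z)).

Lemma cexpD z w : cexp (z + w) = cexp z * cexp w.
Proof.
case: z => a b; case: w => c d; rewrite /cexp /= expRD cosD sinD.
by congr (_ +i* _); ring.
Qed.

Lemma cexp0 : cexp 0 = 1.
Proof. by rewrite /cexp /= expR0 cos0 sin0 !mul1r. Qed.

Lemma cexpX z k : cexp (k%:R * z) = cexp z ^+ k.
Proof.
elim: k => [|k ih]; first by rewrite mul0r cexp0 expr0.
by rewrite -natr1 mulrDl mul1r cexpD ih exprSr.
Qed.

Lemma cabs_cexp z : cabs (cexp z) = expR (complex.Re z).
Proof.
by rewrite /cabs /= !exprMn -mulrDr cos2Dsin2 mulr1 sqrtr_sqr ger0_norm// expR_ge0.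
Qed.

(** The principal logarithm off the real axis.  The argument is expressed by
    acos rather than atan so that it is continuous across the imaginary axis,
    which corresponds to real z under z = i w. *)
Definition clog w : R[i] := ln (cabs w) +i*
  (Num.sg (complex.Im w) * acos (complex.Re w / cabs w)).

Lemma Re_div_cabs_itv w : complex.Im w != 0 -> -1 < complex.Re w / cabs w < 1.
Proof.
move=> w0; have cw : 0 < cabs w.
  by rewrite lt_def cabs_ge0 cabs_eq0 andbT; apply: contraNneq w0 => ->.
rewrite -ltr_norml normrM normfV (ger0_norm (cabs_ge0 _)) ltr_pdivrMr// mul1r.
rewrite -(ltr_pXn2r (n := 2))// ?nnegrE// real_normK ?num_real// cabs_sqr ltrDl.
by rewrite exprn_even_gt0.
Qed.

Lemma clogK w : complex.Im w != 0 -> cexp (clog w) = w.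
Proof.
move=> w0; have cw : 0 < cabs w.
  by rewrite lt_def cabs_ge0 cabs_eq0 andbT; apply: contraNneq w0 => ->.
have /andP[/ltW i1 /ltW i2] := Re_div_cabs_itv w0.
rewrite /cexp /clog /= lnK ?posrE//.
have cosE : cos (Num.sg (complex.Im w) * acos (complex.Re w / cabs w)) = complex.Re w / cabs w.
  have [w00|_|_] := sgrP (complex.Im w); first by rewrite w00 eqxx in w0.
    by rewrite mul1r acosK// in_itv/= i1.
  by rewrite mulN1r cosN acosK// in_itv/= i1.
have sinE : sin (Num.sg (complex.Im w) * acos (complex.Re w / cabs w)) = complex.Im w / cabs w.
  have -> : sin (Num.sg (complex.Im w) * acos (complex.Re w / cabs w)) =
      Num.sg (complex.Im w) * sin (acos (complex.Re w / cabs w)).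
    by have [_|_|_] := sgrP (complex.Im w); rewrite ?mul1r ?mulN1r ?sinN ?mul0r ?sin0.
  rewrite sin_acos ?i1//.
  have -> : 1 - (complex.Re w / cabs w) ^+ 2 = (complex.Im w / cabs w) ^+ 2.
    rewrite !expr_div_n cabs_sqr; field.
    by rewrite -cabs_sqr expf_neq0// gt_eqF.
  by rewrite sqrtr_sqr normrM normfV (ger0_norm (cabs_ge0 _)) mulrA mulr_sg_norm.
rewrite cosE sinE; case: w {i1 i2 cosE sinE w0} cw => a b /= cw.
by congr (_ +i* _); rewrite mulrCA divff ?mulr1// gt_eqF.
Qed.

Lemma Im_clog_le w : complex.Im w != 0 -> 0 <= complex.Re w ->
  `|complex.Im (clog w)| <= pi / 2.
Proof.
move=> w0 rw; rewrite /= normrM.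
have /andP[/ltW i1 /ltW i2] := Re_div_cabs_itv w0.
rewrite normr_sg w0 mul1r ger0_norm ?acos_ge0 ?i1//.
have i0 : acos (complex.Re w / cabs w) \in `[0, pi].
  by rewrite in_itv/= acos_ge0 ?acos_lepi ?i1.
have p0 : (pi / 2 : R) \in `[0, pi].
  by rewrite in_itv/=; have := pi_gt0 R; lra.
rewrite leNgt -ltr_cos// acosK ?in_itv/= ?i1// cos_pihalf -leNgt.
by rewrite divr_ge0.
Qed.

Lemma cos_le_cos x y : `|x| <= y -> y <= pi -> cos y <= cos x.
Proof.
move=> xy ypi; have -> : cos x = cos `|x|.
  by case: (ger0P x); rewrite ?cosN.
have x0 := normr_ge0 x.
have xi : `|x| \in `[0, pi] by rewrite in_itv/= x0 (le_trans xy).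
have yi : y \in `[0, pi] by rewrite in_itv/= ypi (le_trans x0).
by rewrite leNgt ltr_cos// -leNgt.
Qed.

End ComplexLogarithm.

(** * Limits of complex-valued functions *)
Section ComplexLimits.
Variables (R : realType) (T : Type) (F : set_system T).
Hypothesis FF : Filter F.
Implicit Types (f g : T -> R[i]) (z w : R[i]).

Definition ccvg f z := complex.Re (f x) @[x --> F] --> complex.Re z /\
  complex.Im (f x) @[x --> F] --> complex.Im z.

Lemma ccvg_cst z : ccvg (fun _ => z) z.
Proof. by split; exact: cvg_cst. Qed.

Lemma ccvgM f g z w : ccvg f z -> ccvg g w -> ccvg (fun x => f x * g x) (z * w).
Proof.
move=> [f1 f2] [g1 g2]; split.
  have -> : (fun x => complex.Re (f x * g x)) = (fun x =>
    complex.Re (f x) * complex.Re (g x) - complex.Im (f x) * complex.Im (g x)).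
    by apply/funext => x; case: (f x); case: (g x).
  have -> : complex.Re (z * w) =
    complex.Re z * complex.Re w - complex.Im z * complex.Im w by case: z {f1 f2}; case: w {g1 g2}.
  by apply: cvgB; apply: cvgM.
have -> : (fun x => complex.Im (f x * g x)) = (fun x =>
  complex.Re (f x) * complex.Im (g x) + complex.Im (f x) * complex.Re (g x)).
  by apply/funext => x; case: (f x); case: (g x).
have -> : complex.Im (z * w) =
  complex.Re z * complex.Im w + complex.Im z * complex.Re w by case: z {f1 f2}; case: w {g1 g2}.
by apply: cvgD; apply: cvgM.
Qed.

Lemma ccvg_cabs f z : ccvg f z <-> cabs (f x - z) @[x --> F] --> 0.
Proof.
have ReB x : complex.Re (f x - z) = complex.Re (f x) - complex.Re z.
  by case: (f x) => a b; case: z => c d.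
have ImB x : complex.Im (f x - z) = complex.Im (f x) - complex.Im z.
  by case: {ReB} z => c d; case: (f x) => a b.
split=> [[f1 f2]|H].
  apply: (@squeeze_cvgr _ _ _ _ (cst 0) (fun x =>
    `|complex.Re (f x) - complex.Re z| + `|complex.Im (f x) - complex.Im z|)).
  - by apply: nearW => x; rewrite cabs_ge0 -ReB -ImB cabs_le_ReIm.
  - exact: cvg_cst.
  - have c0 (g : T -> R) a : g x @[x --> F] --> a -> `|g x - a| @[x --> F] --> 0.
      move=> ga; rewrite -(normr0 R) -(subrr a); apply: cvg_norm.
      by apply: cvgB => //; exact: cvg_cst.
    by rewrite -(addr0 0); apply: cvgD; exact: c0.
by split; apply/cvgrPdistC_le; move/cvgr0Pnorm_le : H => H e e0; have := H _ e0;
  apply: filterS => x; rewrite ger0_norm// => /(le_trans _); apply;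
  rewrite -?ReB -?ImB ?normRe_cabs ?normIm_cabs.
Qed.

Lemma ccvg_cexp f z : ccvg f z -> ccvg (fun x => cexp (f x)) (cexp z).
Proof.
move=> [f1 f2].
have e1 := continuous_cvg FF (@continuous_expR R (complex.Re z)) f1.
have c1 := continuous_cvg FF (@continuous_cos R (complex.Im z)) f2.
have s1 := continuous_cvg FF (@continuous_sin R (complex.Im z)) f2.
by split; exact: cvgM.
Qed.

End ComplexLimits.

Lemma ccvg_lip (R : realType) (T : Type) (F : set_system T) (FF : Filter F)
    (u : R[i] -> R[i]) (f : T -> R[i]) (z : R[i]) (delta B : R) :
  (forall e, cabs e <= delta -> cabs (u e - u z) <= B * cabs (e - z)) ->
  (\forall x \near F, cabs (f x) <= delta) ->
  ccvg F f z -> ccvg F (fun x => u (f x)) (u z).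
Proof.
move=> uB fd /(ccvg_cabs FF) H; apply/(ccvg_cabs FF).
apply: (@squeeze_cvgr _ _ _ _ (cst 0) (fun x => B * cabs (f x - z))).
- by near=> x; rewrite cabs_ge0 uB//; near: x.
- exact: cvg_cst.
- by rewrite -(mulr0 B); apply: cvgM => //; exact: cvg_cst.
Unshelve. all: by end_near. Qed.

Lemma clog_cvg_right (R : realType) (y : R) : y != 0 ->
  ccvg 0^'+ (fun x : R => clog (x +i* y)) (clog (0 +i* y)).
Proof.
move=> y0.
have cx : x @[x --> (0 : R)^'+] --> (0 : R) by apply: cvg_at_right_filter; exact: cvg_id.
have sq : cabs (x +i* y) @[x --> 0^'+] --> cabs (0 +i* y).
  apply: (continuous_cvg _ (@sqrt_continuous R _)).
  by apply: cvgD; [exact: cvgM|exact: cvg_cst].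
have c0 : 0 < cabs (0 +i* y).
  by rewrite lt_def cabs_ge0 cabs_eq0 eq_complex /= eqxx y0.
split => /=.
  exact: (continuous_cvg _ (continuous_ln c0) sq).
apply: cvgM; first exact: cvg_cst.
apply: (continuous_cvg _ (continuous_acos (Re_div_cabs_itv (w := 0 +i* y) y0))).
by apply: cvgM => //; apply: cvgV => //; rewrite gt_eqF.
Qed.

(** * Scaling exponents *)
Section Scaling.
Variables (R : realType) (n : nat).

Definition scaling_exponent k : R := (n.+1%:R - 2 * k%:R) / n.+1%:R.
Definition parameter_exponent : R := 2 / n.+1%:R.

Lemma scaling_exponent0 : scaling_exponent 0%N = 1.
Proof. by rewrite /scaling_exponent mulr0 subr0 divff// pnatr_eq0. Qed.

(** This identity makes all rescaled coefficients integral powers of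
    e = w^(2/(n+1)). *)
Lemma scaling_exponentD k j : (k + j <= n.+1)%N ->
  scaling_exponent k + scaling_exponent j = (n.+1 - k - j)%:R * parameter_exponent.
Proof.
move=> kj; rewrite /scaling_exponent /parameter_exponent -subnDA natrB// natrD.
by field; rewrite addrC natr1 pnatr_eq0.
Qed.

Lemma norm_scaling_exponent k : (0 < k <= n)%N ->
  `|scaling_exponent k| <= (n%:R - 1) / (n%:R + 1).
Proof.
move=> /andP[k0 kn]; rewrite /scaling_exponent natr1 normrM normfV [`|n.+1%:R|]ger0_norm//.
rewrite ler_wpM2r ?invr_ge0// ler_norml.
have : 1 <= k%:R :> R by rewrite ler1n.
have : k%:R <= n%:R :> R by rewrite ler_nat.
by rewrite -natr1 => ? ?; apply/andP; split; lra.
Qed.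

Lemma edge_cos_gt0 : (0 < n)%N -> 0 < cos ((n%:R - 1) / (n%:R + 1) * (pi / 2) : R).
Proof.
move=> n0; apply: cos_gt0_pihalf.
have p0 := pi_gt0 R.
have n1 : 1 <= n%:R :> R by rewrite ler1n.
have a0 : 0 <= (n%:R - 1) / (n%:R + 1) :> R.
  by rewrite divr_ge0 ?subr_ge0// addr_ge0.
have a1 : (n%:R - 1) / (n%:R + 1) < 1 :> R.
  by rewrite ltr_pdivrMr; lra.
have : 0 <= (n%:R - 1) / (n%:R + 1) * (pi / 2) :> R by rewrite mulr_ge0// divr_ge0// ltW.
have : (n%:R - 1) / (n%:R + 1) * (pi / 2) < 1 * (pi / 2) :> R.
  by rewrite ltr_pM2r// divr_gt0.
by move=> ? ?; apply/andP; split; lra.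
Qed.

Lemma cexp_scaling (Z : R[i]) k j : (k + j <= n.+1)%N ->
  cexp ((scaling_exponent k)%:C * Z) * cexp ((scaling_exponent j)%:C * Z) =
  cexp (parameter_exponent%:C * Z) ^+ (n.+1 - k - j).
Proof.
move=> kj; rewrite -cexpD -mulrDl -rmorphD/= scaling_exponentD// -cexpX.
by rewrite rmorphM/= rmorph_nat mulrA.
Qed.

(** The factor w^(a_k) stays in a closed sector inside the open right
    half-plane, and a factor close to 1 does not leave that half-plane. *)
Lemma Re_cexp_scaled_gt0 (Z u : R[i]) k (g : R) : (0 < k <= n)%N ->
  `|complex.Im Z| <= pi / 2 ->
  g < cos ((n%:R - 1) / (n%:R + 1) * (pi / 2)) -> cabs (u - 1) <= g ->
  0 < complex.Re (cexp ((scaling_exponent k)%:C * Z) * u).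
Proof.
move=> kn Zpi gcos ug; set p := cexp _.
have ReE : complex.Re (p * u) = complex.Re p + complex.Re (p * (u - 1)).
  rewrite mulrBr mulr1; case: (p * u) => x y; case: p => x' y' /=; ring.
have RZ : complex.Im ((scaling_exponent k)%:C * Z) = scaling_exponent k * complex.Im Z.
  by case: (Z) => x y /=; rewrite mul0r addr0.
rewrite ReE {1}/p /= RZ.
have h1 : `|complex.Re (p * (u - 1))| <= cabs p * g.
  by rewrite (le_trans (normRe_cabs _))// cabsM ler_wpM2l.
have pE : cabs p = expR (complex.Re ((scaling_exponent k)%:C * Z)) by rewrite cabs_cexp.
rewrite pE in h1; set ex := expR _ in h1 *.
have ex0 : 0 < ex by exact: expR_gt0.
have h2 : cos ((n%:R - 1) / (n%:R + 1) * (pi / 2)) <= cos (scaling_exponent k * complex.Im Z).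
  apply: cos_le_cos; first by rewrite normrM ler_pM// norm_scaling_exponent.
  have p0 := pi_gt0 R.
  have n1 : 1 <= n%:R :> R by rewrite ler1n; lia.
  have a1 : (n%:R - 1) / (n%:R + 1) <= 1 :> R by rewrite ler_pdivrMr; lra.
  have : (n%:R - 1) / (n%:R + 1) * (pi / 2) <= 1 * (pi / 2) :> R.
    by rewrite ler_wpM2r// divr_ge0// ltW.
  lra.
have h3 : ex * g < ex * cos (scaling_exponent k * complex.Im Z).
  by rewrite ltr_pM2l// (lt_le_trans gcos).
move: h1; rewrite ler_norml => /andP[h1 _].
lra.
Qed.

End Scaling.

(** * From the rescaled equations to the Dyson equation *)
Section BorderedMatrix.
Variables (R : realType) (n : nat) (S : 'M[R]_n.+1).
Hypothesis S_sym : S^T = S.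
Hypothesis S_n : forall i j : 'I_n.+1, (i.+1 + j.+1 = n.+1)%N -> 0 < S i j.
Hypothesis S_n1 : forall i j : 'I_n.+1, (i.+1 + j.+1 = n.+1 + 1)%N -> 0 < S i j.
Hypothesis S_n2 : forall i j : 'I_n.+1, (n.+1 + 2 <= i.+1 + j.+1)%N -> S i j = 0.

(** The border of ones accounts for the term z as a variable of index 0; index k
    of the bordered matrix is the ordinal k - 1 of [S]. *)
Definition bordered k j : R :=
  if (k == 0%N) || (j == 0%N) then 1 else S (inord k.-1) (inord j.-1).

Lemma bordered_sym k j : bordered k j = bordered j k.
Proof. by rewrite /bordered orbC -{1}S_sym mxE. Qed.

Lemma bordered0 k : bordered k 0%N = 1.
Proof. by rewrite /bordered eqxx orbT. Qed.

Lemma borderedS (k j : 'I_n.+1) : bordered k.+1 j.+1 = S k j.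
Proof. by rewrite /bordered /= !inord_val. Qed.

Lemma bordered_n k : (k <= n.+1)%N -> 0 < bordered k (n.+1 - k)%N.
Proof.
move=> kn; rewrite /bordered; case: eqP => //= k0; case: eqP => //= k1.
by apply: S_n; rewrite !inordK; lia.
Qed.

Lemma bordered_n1 k : (0 < k <= n.+1)%N -> 0 < bordered k (n.+2 - k)%N.
Proof.
move=> kn; rewrite /bordered; case: eqP => //= k0; case: eqP => //= k1.
by apply: S_n1; rewrite !inordK; lia.
Qed.

Lemma bordered_sum (k : 'I_n.+1) (f : nat -> R[i]) :
  \sum_(j < n.+3 - k.+1) (bordered k.+1 j)%:C * f j =
  f 0%N + \sum_(j < n.+1) (S k j)%:C * f j.+1.
Proof.
have le : (n.+3 - k.+1 <= n.+2)%N by lia.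
rewrite (big_ord_widen _ (fun j => (bordered k.+1 j)%:C * f j) le) big_mkcond/=.
rewrite big_ord_recl/= bordered0 mul1r; case: ifP => [_|]; last by have := ltn_ord k; lia.
congr (_ + _); apply: eq_bigr => j _; rewrite /bump /= add1n borderedS.
case: ifPn => // kj; rewrite S_n2 ?mul0r//; lia.
Qed.

End BorderedMatrix.

Section Solution.
Variables (R : realType) (n : nat) (S : 'M[R]_n.+1) (c : nat -> R).
Hypothesis S_n2 : forall i j : 'I_n.+1, (n.+1 + 2 <= i.+1 + j.+1)%N -> S i j = 0.
Hypothesis c0 : c 0%N = 1.
Hypothesis c_gt0 : forall k, 0 < c k.

Definition scaled_profile (Z : R[i]) (u : nat -> R[i]) k : R[i] :=
  (c k)%:C * (cexp ((scaling_exponent R n.+1 k)%:C * Z) * u k).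

Lemma scaled_profile_eq Z u (k : 'I_n.+1) : u 0%N = 1 ->
  rescaled_dyson n.+1 (bordered S) c (cexp ((parameter_exponent R n.+1)%:C * Z)) u ->
  scaled_profile Z u k.+1 *
    (cexp Z + \sum_j (S k j)%:C * scaled_profile Z u j.+1) = 1.
Proof.
move=> u0 /(_ k.+1); rewrite /= ltn_ord => /(_ isT) H.
have -> : cexp Z = scaled_profile Z u 0%N.
  by rewrite /scaled_profile c0 u0 scaling_exponent0 !mul1r mulr1.
rewrite -(bordered_sum S_n2 k (scaled_profile Z u)) -[RHS]H mulr_sumr.
apply: eq_bigr => j _; rewrite -cexp_scaling; last by have := ltn_ord j; lia.
rewrite /scaled_profile !rmorphM/=; ring.
Qed.

Lemma scaled_profile_dyson (z Z : R[i]) (u : nat -> R[i]) g : z = 'i * cexp Z ->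
  `|complex.Im Z| <= pi / 2 ->
  g < cos ((n.+1%:R - 1) / (n.+1%:R + 1) * (pi / 2)) ->
  u 0%N = 1 -> (forall k, cabs (u k - 1) <= g) ->
  rescaled_dyson n.+1 (bordered S) c (cexp ((parameter_exponent R n.+1)%:C * Z)) u ->
  dyson_at S z (fun k => 'i * scaled_profile Z u k.+1).
Proof.
move=> zE Zpi gcos u0 ug ueq k.
have Rep : 0 < complex.Re (scaled_profile Z u k.+1).
  rewrite /scaled_profile; set q := cexp _ * _.
  have -> : complex.Re ((c k.+1)%:C * q) = c k.+1 * complex.Re q.
    by case: q => x y /=; rewrite mul0r subr0.
  by rewrite mulr_gt0// (Re_cexp_scaled_gt0 _ Zpi gcos (ug _))//=.
have p0 : scaled_profile Z u k.+1 != 0.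
  by apply: contraTneq Rep => ->; rewrite ltxx.
split; first by rewrite /upper_half_plane /= mulrC ImiRe.
have i2 : 'i * 'i = -1 :> R[i] by rewrite -expr2 sqr_i.
have i0 : 'i != 0 :> R[i] by rewrite eq_complex /= oner_eq0 andbF.
have E := scaled_profile_eq k u0 ueq.
set X := _ + _ in E.
have XE : X = (scaled_profile Z u k.+1)^-1.
  by apply: (mulfI p0); rewrite E divff.
have -> : z + \sum_(j < n.+1) (S k j)%:C * ('i * scaled_profile Z u j.+1) = 'i * X.
  by rewrite zE mulrDr mulr_sumr; congr (_ + _); apply: eq_bigr => j _; rewrite mulrCA.
rewrite XE invfM -mulNr; congr (_ * _).
by apply: (mulfI i0); rewrite mulrN divff// i2.
Qed.

End Solution.

(** * Boundary values and asymptotics of the density *)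
Section BoundaryValues.
Variables (R : realType) (n : nat) (S : 'M[R]_n.+1) (m : R[i] -> 'I_n.+1 -> R[i]).
Variables (c : nat -> R) (u : R[i] -> nat -> R[i]) (g delta B : R).
Hypothesis S_ge0 : forall i j : 'I_n.+1, 0 <= S i j.
Hypothesis S_n2 : forall i j : 'I_n.+1, (n.+1 + 2 <= i.+1 + j.+1)%N -> S i j = 0.
Hypothesis m_sol : solves_vector_dyson S m.
Hypothesis c0 : c 0%N = 1.
Hypothesis c_gt0 : forall k, 0 < c k.
Hypothesis g_cos : g < cos ((n.+1%:R - 1) / (n.+1%:R + 1) * (pi / 2)).
Hypothesis delta_gt0 : 0 < delta.
Hypothesis u_sol : forall e, cabs e <= delta ->
  [/\ u e 0%N = 1, rescaled_dyson n.+1 (bordered S) c e (u e) &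
      forall k, cabs (u e k - 1) <= g].
Hypothesis u_lip : forall e e' k, cabs e <= delta -> cabs e' <= delta ->
  cabs (u e k - u e' k) <= B * cabs (e - e').
Hypothesis u_0 : forall k, u 0 k = 1.

Local Notation expo := (scaling_exponent R n.+1).
Local Notation par_expo := (parameter_exponent R n.+1).
Local Notation edge := ((n.+1%:R - 1) / (n.+1%:R + 1) : R).

Definition branch (Z : R[i]) := scaled_profile n c Z (u (cexp (par_expo%:C * Z))).

Lemma parameter_exponent_gt0 : 0 < par_expo.
Proof. by rewrite /parameter_exponent divr_gt0. Qed.

Lemma cabs_cexp_scaled (a : R) (Z : R[i]) :
  cabs (cexp (a%:C * Z)) = expR (a * complex.Re Z).
Proof. by rewrite cabs_cexp; case: Z => x y /=; rewrite mul0r subr0. Qed.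

(* Both |E| and eta are kept below this radius, so that the power of
   w = eta - i E with exponent [parameter_exponent] has modulus at most delta. *)
Let radius := expR (ln delta / par_expo) / 2.

Lemma radius_gt0 : 0 < radius. Proof. by rewrite divr_gt0 ?expR_gt0. Qed.

Lemma small_parameter (E eta : R) : E != 0 -> 0 <= eta <= radius -> `|E| <= radius ->
  cabs (cexp (par_expo%:C * clog (eta +i* - E))) <= delta.
Proof.
move=> E0 /andP[e0 er] Er; rewrite cabs_cexp_scaled /=.
set w := eta +i* - E.
have w0 : 0 < cabs w by rewrite lt_def cabs_ge0 cabs_eq0 eq_complex /= oppr_eq0 (negbTE E0) andbF.
have wr : cabs w <= expR (ln delta / par_expo).
  rewrite (le_trans (cabs_le_ReIm _))//= normrN ger0_norm//.
  have -> : expR (ln delta / par_expo) = radius + radius by rewrite /radius; lra.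
  exact: lerD.
rewrite -[leRHS]lnK ?posrE// ler_expR mulrC -ler_pdivlMr ?parameter_exponent_gt0//.
by rewrite -[leRHS]expRK ler_ln ?posrE ?expR_gt0.
Qed.

Lemma solution_branch (E eta : R) (k : 'I_n.+1) : E != 0 -> 0 < eta <= radius ->
  `|E| <= radius -> m (E +i* eta) k = 'i * branch (clog (eta +i* - E)) k.+1.
Proof.
move=> E0 /andP[e0 er] Er.
have [u0 ueq ug] := u_sol (small_parameter E0 (introT andP (conj (ltW e0) er)) Er).
have w0 : complex.Im (eta +i* - E) != 0 by rewrite /= oppr_eq0.
have H : dyson_at S (E +i* eta) (fun k => 'i * branch (clog (eta +i* - E)) k.+1).
  apply: (scaled_profile_dyson S_n2 c0 c_gt0 _ _ g_cos) => //.
    rewrite clogK//; apply/eqP.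
    by rewrite eq_complex /= !mul0r !mul1r add0r opprK add0r !eqxx.
  by apply: Im_clog_le => //=; exact: ltW.
exact: (dyson_unique S_ge0 _ (m_sol _) H).
Qed.

Lemma branch_cvg (E : R) k : E != 0 -> `|E| <= radius ->
  ccvg 0^'+ (fun eta => branch (clog (eta +i* - E)) k) (branch (clog (0 +i* - E)) k).
Proof.
move=> E0 Er; have oE0 : - E != 0 by rewrite oppr_eq0.
have cl := clog_cvg_right oE0.
have ce a : ccvg 0^'+ (fun eta => cexp (a%:C * clog (eta +i* - E)))
                      (cexp (a%:C * clog (0 +i* - E))).
  by apply: ccvg_cexp; apply: ccvgM => //; exact: ccvg_cst.
apply: ccvgM; first exact: ccvg_cst.
apply: ccvgM; first exact: ce.
apply: (@ccvg_lip _ _ _ _ (fun e => u e k) _ _ delta B); last exact: ce.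
  move=> e ed; apply: u_lip => //; apply: small_parameter => //.
  by rewrite lexx ltW ?radius_gt0.
near=> eta; apply: small_parameter => //; apply/andP; split; near: eta.
  by apply: filterS (nbhs_right_gt 0) => x; exact: ltW.
by apply: nbhs_right_ltW; exact: radius_gt0.
Unshelve. all: by end_near. Qed.

Lemma dos_branch (E : R) : E != 0 -> `|E| <= radius ->
  self_consistent_dos m E =
  (pi * n.+1%:R)^-1 * \sum_(k < n.+1) complex.Re (branch (clog (0 +i* - E)) k.+1).
Proof.
move=> E0 Er; apply: cvg_lim => //.
apply: cvgM; first exact: cvg_cst.
apply: (@cvg_trans _ ((\sum_(k < n.+1) complex.Re (branch (clog (eta +i* - E)) k.+1))
  @[eta --> 0^'+])); last first.
  by apply: cvg_big => [|k _]; [exact: add_continuous|exact: (branch_cvg k.+1 E0 Er).1].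
apply: near_eq_cvg; near=> eta; apply: eq_bigr => k _.
rewrite solution_branch//; first by rewrite mulrC ImiRe.
apply/andP; split; near: eta; first exact: nbhs_right_gt.
by apply: nbhs_right_ltW; exact: radius_gt0.
Unshelve. all: by end_near. Qed.

Definition weighted_branch (E : R) k :=
  complex.Re (branch (clog (0 +i* - E)) k) * `|E| `^ edge.

Let edgeE : edge = - expo n.+1.
Proof.
rewrite /scaling_exponent -[n.+2%:R]natr1.
have : n.+1%:R + 1 != 0 :> R by rewrite natr1 pnatr_eq0.
by move: (n.+1%:R) => x x1; field.
Qed.

(** The weight is moved inside the exponential, where at the top index it
    cancels the modulus of the power of w. *)
Lemma weighted_branchE (E : R) k : E != 0 ->
  weighted_branch E k = c k * complex.Re (cexp ((expo k)%:C * clog (0 +i* - E) +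
     (edge * ln `|E|)%:C) * u (cexp (par_expo%:C * clog (0 +i* - E))) k).
Proof.
move=> E0; rewrite /weighted_branch /branch /scaled_profile cexpD.
set p := cexp _; set v := u _ _.
have -> : cexp (edge * ln `|E|)%:C = (`|E| `^ edge)%:C.
  by rewrite /cexp /= cos0 sin0 mulr1 mulr0 /powR normr_eq0 (negbTE E0).
rewrite [p * _%:C]mulrC -mulrA; case: (p * v) => x y; rewrite /=; ring.
Qed.

Lemma cabs_imag (x : R) : cabs (0 +i* x) = `|x|.
Proof. by rewrite /cabs /= expr0n add0r sqrtr_sqr. Qed.

Lemma cabs_weight (E : R) k : (k <= n.+1)%N ->
  cabs (cexp ((expo k)%:C * clog (0 +i* - E) + (edge * ln `|E|)%:C)) =
  expR (par_expo * ln `|E|) ^+ (n.+1 - k).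
Proof.
move=> kn; rewrite cexpD cabsM !cabs_cexp /= mul0r subr0 cabs_imag normrN -expRD -expRM_natl.
congr expR; rewrite edgeE /scaling_exponent /parameter_exponent natrB//.
rewrite -[n.+2%:R]natr1; have : n.+1%:R + 1 != 0 :> R by rewrite natr1 pnatr_eq0.
by move: (n.+1%:R) (ln _) => x l x1; field.
Qed.

(** Here w = - i E has argument - sgn(E) pi / 2, so the phase of its power
    depends on the sign of E, but the real part does not, as the cosine is even. *)
Lemma weighted_branch_last (E : R) : E != 0 -> `|E| <= radius ->
  `|weighted_branch E n.+1 - c n.+1 * cos (edge * (pi / 2))| <=
  c n.+1 * B * `|E| `^ par_expo.
Proof.
move=> E0 Er; rewrite weighted_branchE//.
set p := cexp _; set e := cexp (par_expo%:C * _).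
have Rep : complex.Re p = cos (edge * (pi / 2)).
  rewrite /p /cexp /= !mul0r subr0 !addr0 cabs_imag normrN.
  have -> : expo n.+1 * ln `|E| + edge * ln `|E| = 0 by rewrite edgeE; ring.
  rewrite expR0 mul1r acos0 edgeE.
  have [h|_|_] := sgrP (- E).
  - by move/eqP: E0; rewrite -oppr0 -h opprK.
  - by rewrite mul1r mulNr cosN.
  - by rewrite mulN1r mulrN mulNr.
rewrite -Rep -mulrBr normrM gtr0_norm// -mulrA ler_pM2l//.
have -> : complex.Re (p * u e n.+1) - complex.Re p = complex.Re (p * (u e n.+1 - 1)).
  by rewrite mulrBr mulr1; case: (p * _) => x y; case: (p).
rewrite (le_trans (normRe_cabs _))// cabsM cabs_weight// subnn expr0 mul1r.
have ed : cabs e <= delta.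
  by apply: small_parameter => //; rewrite lexx ltW ?radius_gt0.
have d0 : cabs (0 : R[i]) <= delta by rewrite cabs0 ltW.
have := u_lip n.+1 ed d0; rewrite u_0 subr0 => /le_trans; apply.
by rewrite cabs_cexp_scaled /= cabs_imag normrN /powR normr_eq0 (negbTE E0).
Qed.

(** Each step down from the top index gains a factor
    |E|^[parameter_exponent]. *)
Lemma weighted_branch_small (E : R) k : (k <= n)%N -> E != 0 -> `|E| <= radius ->
  `|E| <= 1 -> `|weighted_branch E k| <= c k * (1 + g) * `|E| `^ par_expo.
Proof.
move=> kn E0 Er E1; rewrite weighted_branchE// normrM gtr0_norm// -mulrA ler_pM2l//.
rewrite (le_trans (normRe_cabs _))// cabsM cabs_weight; last exact: leqW.
have ed := small_parameter E0 (introT andP (conj (lexx 0) (ltW radius_gt0))) Er.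
have [_ _ /(_ k) ug] := u_sol ed.
have uk : cabs (u (cexp (par_expo%:C * clog (0 +i* - E))) k) <= 1 + g.
  rewrite -(subrK 1 (u _ _)) (le_trans (cabsD _ _))// cabs1 addrC lerD2l//.
rewrite mulrC ler_pM// ?exprn_ge0 ?expR_ge0//.
rewrite subSn// exprS /powR normr_eq0 (negbTE E0) ler_piMr ?expR_ge0//.
rewrite exprn_ile1 ?expR_ge0// -[leRHS]expR0 ler_expR pmulr_rle0 ?parameter_exponent_gt0//.
by rewrite -ln1 ler_ln ?posrE// normr_gt0.
Qed.

Lemma dos_asymptotics :
  self_consistent_dos m E * `|E| `^ edge @[E --> 0^'] -->
  (pi * n.+1%:R)^-1 * (c n.+1 * cos (edge * (pi / 2))).
Proof.
have abs_cvg : `|x| @[x --> (0 : R)^'] --> (0 : R)^'+.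
  move=> P /= [e /= e0 He]; 
  suff : \forall x \near (0 : R)^', P `|x| by [].
  near=> x; apply: He.
    by rewrite /= sub0r normrN normr_id; near: x; exact: dnbhs0_lt.
  by rewrite normr_gt0; near: x; exact: nbhs_dnbhs_neq.
have pow_cvg : `|x| `^ par_expo @[x --> (0 : R)^'] --> (0 : R).
  exact: (cvg_comp _ _ abs_cvg (powR_cvg0 parameter_exponent_gt0)).
apply: (@cvg_trans _ ((pi * n.+1%:R)^-1 * (\sum_(k < n.+1) weighted_branch E k.+1)
  @[E --> 0^'])).
  apply: near_eq_cvg; near=> E.
  rewrite dos_branch; first last.
  - by near: E; apply: dnbhs0_le; exact: radius_gt0.
  - by near: E; exact: nbhs_dnbhs_neq.
  by rewrite -mulrA mulr_suml.
apply: cvgM; first exact: cvg_cst.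
have squeeze (f : R -> R) (C l : R) :
    (\forall E \near 0^', `|f E - l| <= C * `|E| `^ par_expo) -> f E @[E --> 0^'] --> l.
  move=> fl; apply/subr_cvg0; apply: norm_cvg0.
  apply: (@squeeze_cvgr _ _ _ _ (cst 0) (fun E => C * `|E| `^ par_expo)).
  - by apply: filterS fl => E ->; rewrite normr_ge0.
  - exact: cvg_cst.
  - by rewrite -[X in _ --> X](mulr0 C); apply: cvgM => //; exact: cvg_cst.
rewrite -[X in _ --> X]add0r.
under eq_fun do rewrite big_ord_recr/=.
apply: cvgD; last first.
  apply: (squeeze _ (c n.+1 * B)); near=> E; apply: weighted_branch_last.
  - by near: E; exact: nbhs_dnbhs_neq.
  - by near: E; apply: dnbhs0_le; exact: radius_gt0.
rewrite [X in _ --> X](_ : 0 = \sum_(k < n) (0 : R)); last by rewrite big1.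
apply: cvg_big => [|k _]; first exact: add_continuous.
apply: (squeeze _ (c k.+1 * (1 + g))); near=> E; rewrite subr0.
apply: weighted_branch_small => //.
- by near: E; exact: nbhs_dnbhs_neq.
- by near: E; apply: dnbhs0_le; exact: radius_gt0.
- by near: E; exact: dnbhs0_le.
Unshelve. all: by end_near. Qed.

End BoundaryValues.

Theorem corollary1p4 (R : realType) (n : nat) (S : 'M[R]_n)
    (m : R[i] -> 'I_n -> R[i])
    (hn : (1 <= n)%N)
    (S_sym : S^T = S)
    (S_ge0 : forall i j : 'I_n, 0 <= S i j)
    (S_n : forall i j : 'I_n, (i.+1 + j.+1 = n)%N -> 0 < S i j)
    (S_n1 : forall i j : 'I_n, (i.+1 + j.+1 = n + 1)%N -> 0 < S i j)
    (S_n2 : forall i j : 'I_n, (n + 2 <= i.+1 + j.+1)%N -> S i j = 0)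
    (m_sol : solves_vector_dyson S m) :
  exists c : R, 0 < c /\
    self_consistent_dos m E * `|E| `^ ((n%:R - 1) / (n%:R + 1))
      @[E --> 0^'] --> c.
Proof.
case: n S m hn S_sym S_ge0 S_n S_n1 S_n2 m_sol => // n S m _ S_sym S_ge0 S_n S_n1 S_n2 m_sol.
have [c [c0 c_gt0] branches] :=
  rescaled_branch (bordered_sym S_sym) (bordered_n S_n) (bordered_n1 S_n1).
set gamma := cos ((n.+1%:R - 1) / (n.+1%:R + 1) * (pi / 2) : R).
have gamma_gt0 : 0 < gamma by exact: edge_cos_gt0.
have g0 : 0 < gamma / 2 by rewrite divr_gt0.
have g_cos : gamma / 2 < gamma by lra.
have [delta [B [u [d0 _ u_0 u_sol u_lip]]]] := branches _ g0.
exists ((pi * n.+1%:R)^-1 * (c n.+1 * gamma)); split.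
  by rewrite mulr_gt0 ?mulr_gt0// invr_gt0 mulr_gt0// pi_gt0.
exact: (dos_asymptotics S_ge0 S_n2 m_sol c0 c_gt0 g_cos d0 u_sol u_lip u_0).
Qed.
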